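(* Let $N=2^n$ and let $D\in\mathbb{C}^{N\times N}$ be an invertible diagonal matrix whose diagonal entries are accessible through an oracle $O_D$ acting as $O_D|i\rangle|0^l\rangle=|i\rangle|D_{ii}\rangle$ for $i\in\{0,\dots,N-1\}$, where $|D_{ii}\rangle$ is an (exact) $l$-bit representation of $D_{ii}$. Let $\alpha_D'\ge 1/\min_i|D_{ii}|$. Then one can construct an $(\alpha_D',m_D',0)$-block-encoding of $D^{-1}$ by a quantum circuit that uses $O_D$ and $O_D^\dagger$ exactly once each. Moreover $m_D'=\mathcal{O}(l+\mathrm{polylog}(N))$ if $O_D$ uses $\mathcal{O}(l+\mathrm{polylog}(N))$ ancilla qubits.
   Context: Block-encoding: an $(m+n)$-qubit unitary $U$ is an $(\alpha,m,\epsilon)$-block-encoding of an $n$-qubit operator $M\in\mathbb{C}^{2^n\times 2^n}$ if $\|M-\alpha(\langle 0^m|\otimes I_n)U(|0^m\rangle\otimes I_n)\|\le\epsilon$ in operator norm. Work ancillas used inside the oracle start in and are returned to the all-zero state. Oracle-free unitaries are available as gates; in particular the controlled rotation $|\zeta\rangle|0\rangle\mapsto|\zeta\rangle\bigl(\tfrac{1}{\alpha_D'\zeta}|0\rangle+\sqrt{1-|\tfrac{1}{\alpha_D'\zeta}|^2}\,|1\rangle\bigr)$, where $|\zeta\rangle$ is an $l$-qubit basis state representing the number $\zeta$, is assumed to be implementable exactly. *)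

(* Defs.v *)
From mathcomp Require Import all_boot all_order all_algebra.
From mathcomp Require Import complex.
From mathcomp Require mxtens.
From mathcomp Require Import all_classical all_reals.

Set Implicit Arguments.
Unset Strict Implicit.
Unset Printing Implicit Defensive.

Import Order.TTheory GRing.Theory Num.Theory.

Local Open Scope classical_set_scope.
Local Open Scope complex_scope.
Local Open Scope sesquilinear_scope.
Local Open Scope ring_scope.

(* Operators from q qubits to p qubits.  A basis state is numbered by the
   big-endian value of its bits, so in a tensor product the left factor holds
   the most significant qubits. *)
Notation qop R p q := 'M[R[i]]_(2 ^ p, 2 ^ q) (only parsing).

Definition qtens (R : realType) (p1 q1 p2 q2 : nat)
    (A : qop R p1 q1) (B : qop R p2 q2) : qop R (p1 + p2) (q1 + q2) :=
  castmx (esym (expnD 2 p1 p2), esym (expnD 2 q1 q2)) (mxtens.tensmx A B).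

Definition idq (R : realType) (q : nat) : qop R q q := 1%:M.

(* Vectors of q qubits are operators from 0 qubits (2 ^ 0 reduces to 1). *)
Definition ket (R : realType) (q : nat) (x : 'I_(2 ^ q)) : qop R q 0 :=
  delta_mx x 0.

Definition ord0q (q : nat) : 'I_(2 ^ q) := Ordinal (expn_gt0 2 q).

Definition ket0 (R : realType) (q : nat) : qop R q 0 := ket R (ord0q q).

Definition l2norm (R : realType) (k : nat) (v : 'cV[R[i]]_k) : R :=
  Num.sqrt (\sum_i Normc.normc (v i 0) ^+ 2).

Definition opnorm (R : realType) (m n : nat) (A : 'M[R[i]]_(m, n)) : R :=
  sup [set l2norm (A *m v) | v in [set v : 'cV[R[i]]_n | l2norm v <= 1]].

Definition block_encoding (R : realType) (n : nat) (alpha : R) (m : nat)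
    (eps : R) (U : qop R (m + n) (m + n)) (M : qop R n n) : Prop :=
  U \is unitarymx /\
  opnorm (M - alpha%:C *: (qtens ((ket0 R m)^t*) (idq R n) *m U
                             *m qtens (ket0 R m) (idq R n))) <= eps.

(* Gates on q qubits with access to a black-box unitary on k qubits.  An
   oracle-free gate is an arbitrary unitary on the whole register.  Queries are
   made on the first k qubits; since qubit permutations are oracle-free, this
   does not restrict where the oracle can be applied. *)
Inductive gate (R : realType) (k q : nat) : Type :=
  | OracleFree (V : qop R q q) of V \is unitarymx
  | Query (r : nat) of (k + r = q)%N
  | QueryAdj (r : nat) of (k + r = q)%N.

Definition is_query (R : realType) (k q : nat) (g : gate R k q) : bool :=
  if g is Query _ _ then true else false.

Definition is_query_adj (R : realType) (k q : nat) (g : gate R k q) : bool :=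
  if g is QueryAdj _ _ then true else false.

Definition pad (R : realType) (k r q : nat) (e : (k + r = q)%N)
    (A : qop R k k) : qop R q q :=
  castmx (congr1 (expn 2) e, congr1 (expn 2) e) (qtens A (idq R r)).

Definition gate_op (R : realType) (k q : nat) (O : qop R k k)
    (g : gate R k q) : qop R q q :=
  match g with
  | OracleFree V _ => V
  | Query _ e => pad e O
  | QueryAdj _ e => pad e (O^t*)
  end.

(* The head of the list is the gate applied first.  A circuit does not contain
   the oracle, only places for it. *)
Definition circuit (R : realType) (k q : nat) := seq (gate R k q).

Definition circuit_op (R : realType) (k q : nat) (O : qop R k k)
    (c : circuit R k q) : qop R q q :=
  foldl (fun U g => gate_op O g *m U) 1%:M c.

(* [num] is the number format: [num z] is the number represented by the l-bit
   string z.  The last a qubits are the work ancillas of the oracle; nothing is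
   assumed about O when the last l + a qubits do not start in the zero state. *)
Definition diag_oracle (R : realType) (n l a : nat) (num : 'I_(2 ^ l) -> R[i])
    (D : qop R n n) (O : qop R (n + l + a) (n + l + a)) : Prop :=
  O \is unitarymx /\
  exists z : 'I_(2 ^ n) -> 'I_(2 ^ l),
    (forall i, num (z i) = D i i) /\
    (forall i, O *m qtens (qtens (ket R i) (ket0 R l)) (ket0 R a)
               = qtens (qtens (ket R i) (ket R (z i))) (ket0 R a)).

Definition min_abs_diag (R : realType) (n : nat) (D : qop R n n) : R :=
  \big[Num.min / Normc.normc (D (ord0q n) (ord0q n))]_i Normc.normc (D i i).

(* f = O(l + polylog(N)) over a family of instances, where polylog(N) is a
   polynomial in log N. *)
Definition bigO_polylog (I : Type) (N l f : I -> nat) : Prop :=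
  exists (c : nat) (p : {poly nat}),
    forall i, (f i <= c * (l i + p.[trunc_log 2 (N i)]))%N.

(* Main.v *)
Require Import Defs.
From mathcomp Require Import all_boot all_order all_algebra.
From mathcomp Require Import complex.
From mathcomp Require Import mxtens.
From mathcomp Require Import all_classical all_reals.
From mathcomp Require Import zify.

Set Implicit Arguments.
Unset Strict Implicit.
Unset Printing Implicit Defensive.

Import Order.TTheory GRing.Theory Num.Theory.

Local Open Scope complex_scope.
Local Open Scope sesquilinear_scope.
Local Open Scope ring_scope.

(* With J = |0^m> (x) I, the circuit is U = W0^* Q^* W1 Q W0, where Q is the
   oracle acting next to one extra qubit.  The oracle-free gate W0 reorders the
   qubits, |0^m>|j> |-> |j>|0^l>|0^a>|0>; Q turns this into |j>|z_j>|0^a>|0>;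
   W1 rotates the last qubit, conditionally on z_j, to c|0> + s|1> with
   c = 1 / (alpha * num z_j); and J^* U J is the compression of W1 to the
   orthonormal vectors |j>|z_j>|0^a>|0>, i.e. the diagonal matrix of these c.
   The gates W0 and W1 are only prescribed on an isometric image, and exist
   because every isometry between subspaces extends to a unitary. *)

(** * Adjoints, dimension casts, and extension of isometries to unitaries *)

Lemma adjmx_mul (C : numClosedFieldType) m n p
    (A : 'M[C]_(m, n)) (B : 'M[C]_(n, p)) :
  (A *m B)^t* = B^t* *m A^t*.
Proof. by rewrite trmx_mul map_mxM. Qed.

Lemma adjmx_cast (C : numClosedFieldType) m n m' n'
    (em : m = m') (en : n = n') (A : 'M[C]_(m, n)) :
  (castmx (em, en) A)^t* = castmx (en, em) (A^t*).
Proof. by case: _ / em; case: _ / en; rewrite !castmx_id. Qed.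

Lemma castmx_mulmx (C : pzRingType) m n p m' n' p' (em : m = m')
    (en en' : n = n') (ep : p = p') (A : 'M[C]_(m, n)) (B : 'M[C]_(n, p)) :
  castmx (em, en) A *m castmx (en', ep) B = castmx (em, ep) (A *m B).
Proof.
rewrite (eq_irrelevance en' en).
by case: _ / em; case: _ / en; case: _ / ep; rewrite !castmx_id.
Qed.

Lemma castmx_scalar (C : pzRingType) n n' (e e' : n = n') (a : C) :
  castmx (e, e') a%:M = a%:M.
Proof.
by rewrite (eq_irrelevance e' e); case: _ / e; rewrite castmx_id.
Qed.

(** The columns of [A'] form an orthonormal basis of the orthogonal complement of the range of [A],
    found by Gram-Schmidt. *)
Lemma isometry_complete (C : numClosedFieldType) p n (A : 'M[C]_(p, n)) :
  A^t* *m A = 1%:M ->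
  exists A' : 'M[C]_(p, p - n),
    [/\ A^t* *m A' = 0, A'^t* *m A' = 1%:M &
        A *m A^t* + A' *m A'^t* = 1%:M].
Proof.
move=> AA.
have uA : A^t* \is unitarymx by apply/unitarymxP; rewrite trmxCK.
pose P := orthomx Num.conj (mx_of_hermitian (hermitian1mx _)) (A^t*).
have le_np : (n <= p)%N by rewrite -(mxrank_unitary uA) rank_leq_col.
have rkP : \rank P = (p - n)%N by rewrite rank_ortho mxrank_unitary.
have [B uB sBP] : exists2 B : 'M[C]_(p - n, p),
    B \is unitarymx & (B <= P)%MS.
  rewrite -rkP; exists (schmidt (row_base P)).
    by rewrite schmidt_unitarymx // rank_leq_col.
  by rewrite eqmx_schmidt_free ?row_base_free // eq_row_base.
exists (B^t*).
have BA0 : B *m A = 0 by rewrite -[A]trmxCK; apply/orthomx1P.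
have AB0 : A^t* *m B^t* = 0 by rewrite -adjmx_mul BA0 trmx0 map_mx0.
rewrite trmxCK; split=> //; first exact/unitarymxP.
have uM : col_mx (A^t*) B \is unitarymx.
  apply/unitarymxP.
  rewrite tr_col_mx map_row_mx mul_col_row trmxCK AA BA0 AB0.
  by rewrite (unitarymxP uB) -scalar_mx_block.
(* The stacked matrix has orthonormal rows and is square, so its adjoint is a left inverse too; this
   is the completeness relation. *)
have := mulmxKtV (1%:M : 'M_p) uM (subnKC le_np).
by rewrite mul1mx tr_col_mx map_row_mx mul_row_col trmxCK.
Qed.

(** Complete both isometries; [V] then sends range to range and complement to complement. *)
Lemma unitary_extension (C : numClosedFieldType) p n (A B : 'M[C]_(p, n)) :
  A^t* *m A = 1%:M -> B^t* *m B = 1%:M ->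
  exists2 V : 'M[C]_p, V \is unitarymx & V *m A = B.
Proof.
move=> AA BB.
have [A' [AA'0 A'A' AE]] := isometry_complete AA.
have [B' [BB'0 B'B' BE]] := isometry_complete BB.
have A'A0 : A'^t* *m A = 0.
  by rewrite -[A in LHS]trmxCK -adjmx_mul AA'0 trmx0 map_mx0.
exists (B *m A^t* + B' *m A'^t*).
  apply/unitarymxP; rewrite linearD map_mxD /= !adjmx_mul !trmxCK.
  rewrite mulmxDl !mulmxDr !mulmxA -!(mulmxA _ _ A) -!(mulmxA _ _ A').
  by rewrite AA AA'0 A'A0 A'A' !mulmx0 !mul0mx !mulmx1 addr0 add0r.
by rewrite mulmxDl -!mulmxA AA A'A0 mulmx0 mulmx1 addr0.
Qed.

(** * Tensor products of qubit operators *)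

Section QubitTensor.
Variable R : realType.

Lemma qtens_mul p1 q1 r1 p2 q2 r2
    (A : 'M[R[i]]_(2 ^ p1, 2 ^ q1)) (B : 'M[R[i]]_(2 ^ p2, 2 ^ q2))
    (C : 'M[R[i]]_(2 ^ q1, 2 ^ r1)) (D : 'M[R[i]]_(2 ^ q2, 2 ^ r2)) :
  qtens A B *m qtens C D = qtens (A *m C) (B *m D).
Proof. by rewrite castmx_mulmx tensmx_mul. Qed.

Lemma qtens_adj p1 q1 p2 q2
    (A : 'M[R[i]]_(2 ^ p1, 2 ^ q1)) (B : 'M[R[i]]_(2 ^ p2, 2 ^ q2)) :
  (qtens A B)^t* = qtens (A^t*) (B^t*).
Proof. by rewrite adjmx_cast trmx_tens map_mxT. Qed.

Lemma tensmx11 (C : comPzRingType) m n :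
  tensmx (1%:M : 'M[C]_m) (1%:M : 'M[C]_n) = 1%:M.
Proof.
apply/matrixP=> i j.
case: (mxtens_indexP i) => i0 i1; case: (mxtens_indexP j) => j0 j1.
rewrite tensmxE !mxE -natrM mulnb (can_eq (@mxtens_indexK m n)).
by rewrite xpair_eqE.
Qed.

Lemma qtens11 p q : qtens (idq R p) (idq R q) = 1%:M.
Proof. by rewrite /qtens tensmx11 castmx_scalar. Qed.

Lemma qtens0 p1 q1 p2 q2 (A : 'M[R[i]]_(2 ^ p1, 2 ^ q1)) :
  qtens A (0 : 'M[R[i]]_(2 ^ p2, 2 ^ q2)) = 0.
Proof.
by rewrite /qtens tensmx0; apply/matrixP=> i j; rewrite castmxE !mxE.
Qed.

Lemma qtensDl p1 q1 p2 q2 (A A' : 'M[R[i]]_(2 ^ p1, 2 ^ q1))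
    (B : 'M[R[i]]_(2 ^ p2, 2 ^ q2)) :
  qtens (A + A') B = qtens A B + qtens A' B.
Proof. by apply/matrixP=> i j; rewrite !(castmxE, mxE) mulrDl. Qed.

Definition qpair p q (x : 'I_(2 ^ p)) (y : 'I_(2 ^ q)) : 'I_(2 ^ (p + q)) :=
  cast_ord (esym (expnD 2 p q)) (mxtens_index (x, y)).

Definition qfst p q (x : 'I_(2 ^ (p + q))) : 'I_(2 ^ p) :=
  (mxtens_unindex (cast_ord (expnD 2 p q) x)).1.

Definition qsnd p q (x : 'I_(2 ^ (p + q))) : 'I_(2 ^ q) :=
  (mxtens_unindex (cast_ord (expnD 2 p q) x)).2.

Lemma qpairK1 p q (x : 'I_(2 ^ p)) (y : 'I_(2 ^ q)) : qfst (qpair x y) = x.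
Proof. by rewrite /qfst /qpair cast_ordKV mxtens_indexK. Qed.

Lemma qpairK2 p q (x : 'I_(2 ^ p)) (y : 'I_(2 ^ q)) : qsnd (qpair x y) = y.
Proof. by rewrite /qsnd /qpair cast_ordKV mxtens_indexK. Qed.

Lemma qtens_ket p q (x : 'I_(2 ^ p)) (y : 'I_(2 ^ q)) :
  qtens (ket R x) (ket R y) = ket R (qpair x y).
Proof.
apply/matrixP=> i j; rewrite castmxE !esymK !mxE.
set i' := cast_ord _ i; rewrite /ket !ord1 !eqxx !andbT -natrM mulnb.
rewrite -(inj_eq (@cast_ord_inj _ _ (expnD 2 p q))) /qpair cast_ordKV -/i'.
by rewrite -xpair_eqE -(can_eq (@mxtens_indexK _ _)) mxtens_unindexK.
Qed.

Lemma ket_mul q (x y : 'I_(2 ^ q)) :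
  (ket R x)^t* *m ket R y = (x == y)%:R%:M.
Proof.
rewrite /ket trmx_delta map_delta_mx mul_delta_mx_cond.
apply/matrixP=> i j; rewrite !ord1 !mxE; case: (x == y) => //=.
  by rewrite mulr1n mxE.
by rewrite mulr0n mxE.
Qed.

(** A state is an operator from 0 qubits, so an inner product of states leaves a factor [idq R 0]
    and a [+ 0] in the dimensions; both are removed here. *)
Lemma qtens_idq0 p q (ep : (2 ^ (p + 0) = 2 ^ p)%N)
    (eq : (2 ^ (q + 0) = 2 ^ q)%N)
    (A : 'M[R[i]]_(2 ^ p, 2 ^ q)) :
  castmx (ep, eq) (qtens A (idq R 0)) = A.
Proof.
by rewrite /qtens /idq tens_mx_scalar scale1r !castmx_comp castmx_id.
Qed.

(** * Conditional rotation of one qubit *)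

Definition ket1 : 'M[R[i]]_(2 ^ 1, 2 ^ 0) := ket R (inord 1 : 'I_(2 ^ 1)).

Lemma ket0_mul q : (ket0 R q)^t* *m ket0 R q = 1%:M.
Proof. by rewrite ket_mul eqxx. Qed.

Lemma ket1_mul : ket1^t* *m ket1 = 1%:M.
Proof. by rewrite ket_mul eqxx. Qed.

Lemma ket01_mul : (ket0 R 1)^t* *m ket1 = 0.
Proof. by rewrite ket_mul -val_eqE /= inordK // raddf0. Qed.

Lemma ket10_mul : ket1^t* *m ket0 R 1 = 0.
Proof. by rewrite ket_mul -val_eqE /= inordK // raddf0. Qed.

(** With [s = sqrt (1 - |c|^2)], the map |x>|0> |-> |x>(c_x|0> + s_x|1>) is an isometry, hence
    extends to a unitary. *)
Lemma controlled_rotation k (c : 'rV[R[i]]_(2 ^ k)) :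
  (forall x, `|c 0 x| <= 1) ->
  exists (s : 'rV[R[i]]_(2 ^ k)) (V : 'M[R[i]]_(2 ^ (k + 1))),
    V \is unitarymx /\
    V *m qtens (idq R k) (ket0 R 1)
      = qtens (diag_mx c) (ket0 R 1) + qtens (diag_mx s) ket1.
Proof.
move=> c1; pose s : 'rV[R[i]]_(2 ^ k) := \row_x sqrtC (1 - `|c 0 x| ^+ 2).
have s_ge0 x : 0 <= 1 - `|c 0 x| ^+ 2 by rewrite subr_ge0 expr_le1 ?c1.
have cs1 : (diag_mx c)^t* *m diag_mx c + (diag_mx s)^t* *m diag_mx s = 1%:M.
  rewrite !tr_diag_mx !map_diag_mx !mulmx_diag -linearD -diag_const_mx /=.
  congr diag_mx; apply/rowP => x; rewrite !mxE ![Num.conj _ * _]mulrC -!normCK.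
  by rewrite (ger0_norm (x := sqrtC _)) ?sqrtC_ge0 // sqrtCK addrC subrK.
have [|| V uV VE] := unitary_extension (A := qtens (idq R k) (ket0 R 1))
    (B := qtens (diag_mx c) (ket0 R 1) + qtens (diag_mx s) ket1).
- rewrite qtens_adj qtens_mul ket0_mul trmx1 map_mx1 mul1mx.
  exact: (qtens11 k 0).
- rewrite [(_ + _)^T]linearD map_mxD /= !qtens_adj mulmxDl !mulmxDr !qtens_mul.
  rewrite ket0_mul ket1_mul ket01_mul ket10_mul !qtens0 addr0 add0r.
  by rewrite -qtensDl cs1; exact: (qtens11 k 0).
by exists s, V.
Qed.

(** Projecting the last qubit onto |0> kills the [s] branch. *)
Lemma rotation_block k n (c s : 'rV[R[i]]_(2 ^ k)) (V : 'M[R[i]]_(2 ^ (k + 1)))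
    (Y : 'M[R[i]]_(2 ^ k, 2 ^ n)) :
  V *m qtens (idq R k) (ket0 R 1)
    = qtens (diag_mx c) (ket0 R 1) + qtens (diag_mx s) ket1 ->
  (qtens Y (ket0 R 1))^t* *m (V *m qtens Y (ket0 R 1))
    = qtens (Y^t* *m diag_mx c *m Y) (idq R 0).
Proof.
(* [VE] only describes [V] on |0> in the last qubit, so [Y] is factored out to its right. *)
move=> VE; have YE : qtens Y (ket0 R 1)
    = qtens (idq R k) (ket0 R 1) *m qtens Y (idq R 0).
  by rewrite qtens_mul mul1mx mulmx1.
rewrite [in X in _ *m X]YE mulmxA VE mulmxDl !qtens_mul !mulmx1.
rewrite qtens_adj mulmxDr !qtens_mul ket0_mul ket01_mul qtens0 addr0.
by rewrite mulmxA.
Qed.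

(** * The oracle acting beside spare qubits *)

Lemma pad_mul k r q n (e : (k + r = q)%N) (en : (2 ^ (n + 0) = 2 ^ n)%N)
    (O : 'M[R[i]]_(2 ^ k)) (X : 'M[R[i]]_(2 ^ k, 2 ^ n)) :
  pad e O *m castmx (congr1 (expn 2) e, en) (qtens X (ket0 R r))
    = castmx (congr1 (expn 2) e, en) (qtens (O *m X) (ket0 R r)).
Proof. by rewrite castmx_mulmx qtens_mul mul1mx. Qed.

Lemma pad_adj k r q (e : (k + r = q)%N) (O : 'M[R[i]]_(2 ^ k)) :
  (pad e O)^t* = pad e (O^t*).
Proof. by rewrite adjmx_cast qtens_adj trmx1 map_mx1. Qed.

Lemma pad_unitary k r q (e : (k + r = q)%N) (O : 'M[R[i]]_(2 ^ k)) :
  O \is unitarymx -> pad e O \is unitarymx.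
Proof.
move=> /unitarymxP uO; apply/unitarymxP.
by rewrite pad_adj castmx_mulmx qtens_mul uO mulmx1 qtens11 castmx_scalar.
Qed.

(** * Norms and the bound on the rotation amplitudes *)

Lemma opnorm0 m n : opnorm (0 : 'M[R[i]]_(m, n)) = 0.
Proof.
have l2norm0 k : l2norm (0 : 'cV[R[i]]_k) = 0.
  rewrite /l2norm big1 ?sqrtr0 // => i _.
  by rewrite mxE Normc.normc0 expr0n.
rewrite /opnorm -[RHS](sup1 0); congr sup; apply/seteqP; split=> x /=.
  by move=> [v _ <-]; rewrite mul0mx l2norm0.
by move=> ->; exists 0; rewrite ?mulmx0 l2norm0 ?ler01.
Qed.

Lemma min_abs_diag_le n (D : 'M[R[i]]_(2 ^ n)) j :
  min_abs_diag D <= Normc.normc (D j j).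
Proof. exact: bigmin_le. Qed.

Lemma min_abs_diag_gt0 n (D : 'M[R[i]]_(2 ^ n)) :
  (forall j, D j j != 0) -> 0 < min_abs_diag D.
Proof.
have normc_gt0 (z : R[i]) : z != 0 -> 0 < Normc.normc z.
  move=> z0; rewrite lt0r; apply/andP; split.
    by apply: contraNneq z0 => /Normc.eq0_normc ->.
  by case: z {z0} => a b; exact: sqrtr_ge0.
by move=> D0; apply: lt_bigmin => [|j _]; apply: normc_gt0.
Qed.

(** From [1 <= alpha * min_abs_diag D <= alpha * |D j j|]; thus the inverse is admissible as a
    rotation amplitude. *)
Lemma scaled_inverse_le1 n (D : 'M[R[i]]_(2 ^ n)) alpha j :
  (forall j, D j j != 0) -> 1 / min_abs_diag D <= alpha ->
  `|(alpha%:C * D j j)^-1| <= 1.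
Proof.
move=> D0 le_alpha; have m0 := min_abs_diag_gt0 D0.
have a0 : 0 < alpha by apply: lt_le_trans le_alpha; rewrite divr_gt0.
rewrite normfV invf_le1 ?normr_gt0; last first.
  by rewrite mulf_neq0 // eq_complex /= negb_and gt_eqF.
rewrite normrM (ger0_norm (x := alpha%:C)) ?ler0c ?(ltW a0) //.
have -> : `|D j j| = (Normc.normc (D j j))%:C by [].
rewrite -rmorphM -[leLHS]/(1%:C) lecR.
rewrite ler_pdivrMr // in le_alpha.
by apply: le_trans le_alpha _; rewrite ler_pM2l // min_abs_diag_le.
Qed.

End QubitTensor.

(** * Ancilla count and inverses of diagonal matrices *)

Lemma bigO_polylog_addl1 (I : Type) (N l a : I -> nat) :
  bigO_polylog N l a -> bigO_polylog N l (fun i => l i + a i + 1)%N.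
Proof.
(* The extra multiple absorbs [l i], and the constant added to [p] absorbs the one extra qubit. *)
move=> [c [p le_a]]; exists c.+1, (p + 1) => i.
have := le_a i; rewrite hornerD hornerC.
set P := p.[_]; move: P => P.
by rewrite -[(P + 1)%R]/(P + 1)%N; lia.
Qed.

Lemma diag_unitmx_neq0 (F : fieldType) n (d : 'rV[F]_n) :
  diag_mx d \in unitmx -> forall j, d 0 j != 0.
Proof.
by rewrite unitmxE det_diag unitfE => /prodf_neq0 d0 j; exact: d0.
Qed.

Lemma invmx_diag (F : fieldType) n (d : 'rV[F]_n) :
  (forall j, d 0 j != 0) -> invmx (diag_mx d) = diag_mx (\row_j (d 0 j)^-1).
Proof.
move=> d0; have dV : diag_mx d *m diag_mx (\row_j (d 0 j)^-1) = 1%:M.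
  rewrite mulmx_diag -diag_const_mx; congr diag_mx.
  by apply/rowP => j; rewrite !mxE divff.
have [ud _] := mulmx1_unit dV.
by rewrite -[LHS]mulmx1 -dV mulKmx.
Qed.

Theorem proposition6 (R : realType) :
  exists m : nat -> nat -> nat -> nat,
    (forall (n l a : nat) (num : 'I_(2 ^ l) -> R[i]) (alpha : R),
       exists c : circuit R (n + l + a) (m n l a + n),
         count (@is_query _ _ _) c = 1%N /\
         count (@is_query_adj _ _ _) c = 1%N /\
         forall (D : 'M[R[i]]_(2 ^ n))
                (O : 'M[R[i]]_(2 ^ (n + l + a))),
           is_diag_mx D -> D \in unitmx ->
           diag_oracle num D O ->
           1 / min_abs_diag D <= alpha ->
           block_encoding alpha 0 (circuit_op O c) (invmx D)) /\
    (forall (I : Type) (n l a : I -> nat),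
       bigO_polylog (fun i => 2 ^ n i)%N l a ->
       bigO_polylog (fun i => 2 ^ n i)%N l (fun i => m (n i) (l i) (a i))).
Proof.
(* Ancillas: [l] for the value, [a] for the oracle's work space, one for the rotation. *)
exists (fun n l a => l + a + 1)%N; split; last first.
  by move=> I n l a; exact: bigO_polylog_addl1.
move=> n l a num alpha; rewrite /=.
(* Casting along [e] only identifies dimensions; the qubits are reordered by [U0] below. *)
have e : (n + l + a + 1 = l + a + 1 + n)%N by lia.
pose ee := congr1 (expn 2) e; pose en := congr1 (expn 2) (addn0 n).
(* The circuit is fixed before D is known, so the rotation must be unitary on
   bit strings that represent no entry of D as well: there c is set to 0. *)
pose g (y : R[i]) :=
  if `|(alpha%:C * y)^-1| <= 1 then (alpha%:C * y)^-1 else 0.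
pose c : 'rV[R[i]]_(2 ^ (n + l + a)) := \row_x g (num (qsnd (qfst x))).
have [|s [W [uW WE]]] := controlled_rotation (c := c).
  by move=> x; rewrite mxE /g; case: ifP; rewrite ?normr0 ?ler01.
have uV : castmx (ee, ee) W \is unitarymx.
  apply/unitarymxP; rewrite adjmx_cast castmx_mulmx (unitarymxP uW).
  exact: castmx_scalar.
(* [X z] is the isometry |j> |-> |j>|z_j>|0^a>: constant zero [z] gives the oracle's input, the true
   [z] its output. *)
pose f (z : 'I_(2 ^ n) -> 'I_(2 ^ l)) j := qpair (qpair j (z j)) (ord0q a).
pose X z : 'M[R[i]]_(2 ^ (n + l + a), 2 ^ n) := colsub (f z) 1%:M.
have XX M z : (X z)^t* *m M *m X z = mxsub (f z) (f z) M.
  rewrite /X trmx_mxsub trmx1 map_mxsub map_mx1 -rowsubE mulmx_colsub mulmx1.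
  by apply/matrixP => i j; rewrite !mxE.
have fI z : injective (f z).
  by move=> i j /(congr1 (fun x => qfst (qfst x))); rewrite !qpairK1.
pose K z := castmx (ee, en) (qtens (X z) (ket0 R 1)).
pose J := qtens (ket0 R (l + a + 1)) (idq R n).
have JJ : J^t* *m J = 1%:M.
  rewrite qtens_adj qtens_mul ket0_mul trmx1 map_mx1 mul1mx.
  exact: (qtens11 R 0 n).
have KK z : (K z)^t* *m K z = 1%:M.
  rewrite adjmx_cast castmx_mulmx qtens_adj qtens_mul ket0_mul.
  have := XX 1%:M z; rewrite mulmx1 => ->.
  rewrite qtens_idq0; apply/matrixP => i j.
  by rewrite !mxE (inj_eq (fI z)).
(* [U0] is W0 of the overview. Its target uses the zero string, so it is fixed before [D] and [O]
   are known. *)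
have [U0 uU0 U0J] := unitary_extension JJ (KK (fun=> ord0q l)).
have uU0' : U0^t* \is unitarymx by rewrite trmxC_unitary.
exists [:: OracleFree _ uU0; Query _ e; OracleFree _ uV; QueryAdj _ e;
  OracleFree _ uU0'].
split; [by []|split; [by []|]] => D O.
move=> /diag_mxP[d ->{D}] uD [uO [z [zD OE]]] le_alpha.
have d0 := diag_unitmx_neq0 uD.
split.
  rewrite /circuit_op /=.
  have uQ : pad e O \is unitarymx by exact: pad_unitary.
  have uQ' : pad e (O^t*) \is unitarymx by rewrite -pad_adj trmxC_unitary.
  rewrite mulmx1; apply: (mul_unitarymx uU0').
  apply: (mul_unitarymx uQ').
  exact: (mul_unitarymx uV (mul_unitarymx uQ uU0)).
have OX : O *m X (fun=> ord0q l) = X z.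
  apply/matrixP => i j; rewrite /X mulmx_colsub mulmx1.
  have := OE j; rewrite /ket0 !qtens_ket /ket -colE => /matrixP/(_ i 0).
  by rewrite !mxE eqxx andbT.
have QK : pad e O *m K (fun=> ord0q l) = K z by rewrite pad_mul OX.
have D0 j : diag_mx d j j != 0 by rewrite mxE eqxx mulr1n.
have alpha0 : alpha%:C != 0.
  have : 0 < alpha.
    by apply: lt_le_trans le_alpha; rewrite divr_gt0 ?min_abs_diag_gt0.
  by move=> /gt_eqF alpha0; rewrite eq_complex /= alpha0.
(* On strings produced by the oracle the test in [g] succeeds, so the default 0 is never taken. *)
have Oc j : alpha%:C * c 0 (f z j) = (d 0 j)^-1.
  have zj : num (z j) = d 0 j by rewrite zD mxE eqxx mulr1n.
  have := scaled_inverse_le1 j D0 le_alpha.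
  rewrite /c /f !mxE eqxx mulr1n qpairK1 qpairK2 zj /g => ->.
  by rewrite invfM mulrA divff // mul1r.
set U := circuit_op _ _.
(* The gates on either side of the rotation carry [J] to [K z] and its adjoint to that of [K z],
   leaving the compression of the rotation. *)
have UE : J^t* *m U *m J = mxsub (f z) (f z) (diag_mx c).
  rewrite /U /circuit_op /= mulmx1 -!mulmxA U0J QK !mulmxA -adjmx_mul U0J.
  rewrite -pad_adj -adjmx_mul QK -mulmxA adjmx_cast castmx_mulmx.
  by rewrite castmx_mulmx (rotation_block _ WE) qtens_idq0 XX.
have -> : qtens ((ket0 R (l + a + 1))^t*) (idq R n) = J^t*.
  by rewrite qtens_adj trmx1 map_mx1.
rewrite UE invmx_diag //.
suff -> : diag_mx (\row_j (d 0 j)^-1)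
    = alpha%:C *: mxsub (f z) (f z) (diag_mx c).
  by rewrite subrr opnorm0.
(* Injectivity of [f z] makes the off-diagonal entries of the compression vanish. *)
apply/matrixP => i j; rewrite !mxE -Oc (inj_eq (fI z)) !mxE.
by case: eqP => [->|_]; rewrite ?mulr1n ?mulr0n ?mulr0.
Qed.
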